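(* $k'(4)=k(4)=2$, $k'(5)=k(5)=3$, and $k'(7)=k(7)=4$.
   Context: Let $V$ be a finite set of points in $\mathbb{R}^d$. Two distinct points $p,q\in V$ form a double-normal pair if $V$ lies between (i.e. in the closed slab bounded by) the two parallel hyperplanes $H_p,H_q$ passing through $p$ and $q$, respectively, and orthogonal to the segment $pq$. The pair is strict if moreover $V\cap(H_p\cup H_q)=\{p,q\}$. The (strict) double-normal graph of $V$ is the graph with vertex set $V$ in which two points are joined by an edge if and only if they form a (strict) double-normal pair. $K_k(r)$ denotes the complete $k$-partite graph with all parts of size $r$. $k(d)$ is the largest integer $k$ such that for every $r\in\mathbb{N}$ there is a double-normal graph of some finite point set in $\mathbb{R}^d$ that contains $K_k(r)$ as a (not necessarily induced) subgraph. $k'(d)$ is defined in the same way with strict double-normal graphs in place of double-normal graphs. *)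

(* Defs.v *)
From mathcomp Require Import all_boot all_order all_algebra.
From mathcomp Require Import finmap classical_sets reals.

Set Implicit Arguments.
Unset Strict Implicit.
Unset Printing Implicit Defensive.

Import GRing.Theory Num.Theory.
Local Open Scope ring_scope.
Local Open Scope classical_set_scope.

Definition dot (R : realType) (d : nat) (u v : 'rV[R]_d) : R :=
  \sum_(i < d) u 0 i * v 0 i.

Definition hyperplane (R : realType) (d : nat) (p u : 'rV[R]_d) :
    set 'rV[R]_d :=
  [set x | dot (x - p) u = 0].

(* The closed slab bounded by [hyperplane p (q - p)] and
   [hyperplane q (q - p)]. *)
Definition slab (R : realType) (d : nat) (p q : 'rV[R]_d) : set 'rV[R]_d :=
  [set x | 0 <= dot (x - p) (q - p) /\ dot (x - q) (q - p) <= 0].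

Definition double_normal (R : realType) (d : nat) (V : {fset 'rV[R]_d})
    (p q : 'rV[R]_d) : Prop :=
  p <> q /\ [set x | x \in V] `<=` slab p q.

Definition strict_double_normal (R : realType) (d : nat)
    (V : {fset 'rV[R]_d}) (p q : 'rV[R]_d) : Prop :=
  double_normal V p q /\
  [set x | x \in V] `&` (hyperplane p (q - p) `|` hyperplane q (q - p)) =
  [set p; q].

(* A graph is given by the adjacency relation on its type of vertices; here
   the vertices are the elements of [V]. *)
Definition dn_graph (R : realType) (d : nat) (V : {fset 'rV[R]_d}) :
    V -> V -> Prop :=
  fun p q => double_normal V (val p) (val q).

Definition strict_dn_graph (R : realType) (d : nat) (V : {fset 'rV[R]_d}) :
    V -> V -> Prop :=
  fun p q => strict_double_normal V (val p) (val q).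

(* K_k(r): the vertex (i, a) is the a-th vertex of the i-th part. *)
Definition complete_multipartite (k r : nat) :
    'I_k * 'I_r -> 'I_k * 'I_r -> Prop :=
  fun x y => x.1 <> y.1.

(* H is a, not necessarily induced, subgraph of G. *)
Definition contains_subgraph (S T : Type) (G : T -> T -> Prop)
    (H : S -> S -> Prop) : Prop :=
  exists f : S -> T, injective f /\ forall x y, H x y -> G (f x) (f y).

Definition is_largest (P : nat -> Prop) (m : nat) : Prop :=
  P m /\ forall n, P n -> (n <= m)%N.

(* [k_eq R d m] is k(d) = m and [k'_eq R d m] is k'(d) = m; both include
   the existence of the largest integer. *)
Definition k_eq (R : realType) (d m : nat) : Prop :=
  is_largest (fun k => forall r : nat, exists V : {fset 'rV[R]_d},
    contains_subgraph (@dn_graph R d V) (@complete_multipartite k r)) m.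

Definition k'_eq (R : realType) (d m : nat) : Prop :=
  is_largest (fun k => forall r : nat, exists V : {fset 'rV[R]_d},
    contains_subgraph (@strict_dn_graph R d V) (@complete_multipartite k r)) m.

(* Main.v *)
(* Upper bounds.  Let K_k(r) be contained in a double-normal graph with r huge.
   Any triangle whose vertices do not all lie in one part is nonobtuse.  By
   Ramsey's theorem every part contains a long sequence of points all of whose
   differences have almost the same direction u_i, and comparing slabs at
   different scales shows that u_i is almost orthogonal to the difference of any
   two points of the other parts, however small that difference is.  So, for one
   suitable point p_i in each part, the u_i are almost orthonormal and the
   differences p_i - p_j are almost orthogonal to all of them: the k points p_i,
   which form no obtuse angle, live almost in dimension d - k.  This is
   impossible for 3 points in dimension 1 and for 5 points in dimension 2 (a
   quantitative Danzer-Gruenbaum theorem that is insensitive to the scales of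
   the distances), so k >= 3 forces d <> k + 1 and k >= 5 forces d <> k + 2.

   Lower bounds.  In R^(n + k), k <= n + 1, place k points at the vertices of
   an acute simplex in R^n and bend short arcs at them into k new orthogonal
   directions. *)

Require Import Defs.
From mathcomp Require Import all_boot all_order all_algebra.
From mathcomp Require Import finmap classical_sets reals.
From mathcomp Require Import boolp ring lra.

Set Implicit Arguments.
Unset Strict Implicit.
Unset Printing Implicit Defensive.

Import Order.TTheory GRing.Theory Num.Theory.

Section EuclideanSpace.
Context {R : realType} {d : nat}.
Implicit Types (u v w : 'rV[R]_d) (c : R).
Local Open Scope ring_scope.

Lemma dotC u v : dot u v = dot v u.
Proof. by apply: eq_bigr => i _; rewrite mulrC. Qed.

Lemma dotDl u v w : dot (u + v) w = dot u w + dot v w.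
Proof. by rewrite /dot -big_split; apply: eq_bigr => i _; rewrite !mxE mulrDl. Qed.

Lemma dotZl c u v : dot (c *: u) v = c * dot u v.
Proof. by rewrite /dot mulr_sumr; apply: eq_bigr => i _; rewrite !mxE mulrA. Qed.

Lemma dotNl u v : dot (- u) v = - dot u v.
Proof. by rewrite -scaleN1r dotZl mulN1r. Qed.

Lemma dotBl u v w : dot (u - v) w = dot u w - dot v w.
Proof. by rewrite dotDl dotNl. Qed.

Lemma dotDr u v w : dot u (v + w) = dot u v + dot u w.
Proof. by rewrite dotC dotDl !(dotC u). Qed.

Lemma dotZr c u v : dot u (c *: v) = c * dot u v.
Proof. by rewrite dotC dotZl dotC. Qed.

Lemma dotNr u v : dot u (- v) = - dot u v.
Proof. by rewrite dotC dotNl dotC. Qed.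

Lemma dotBr u v w : dot u (v - w) = dot u v - dot u w.
Proof. by rewrite dotDr dotNr. Qed.

Definition dotE := (dotBl, dotBr, dotDl, dotDr, dotNl, dotNr, dotZl, dotZr).

Lemma dot_ge0 u : 0 <= dot u u.
Proof. by apply: sumr_ge0 => i _; rewrite -expr2 sqr_ge0. Qed.

Lemma dot_eq0 u : dot u u = 0 -> u = 0.
Proof.
move=> /eqP; rewrite psumr_eq0 => [/allP u0|i _]; last by rewrite -expr2 sqr_ge0.
apply/rowP => i; have := u0 i (mem_index_enum i).
by rewrite -expr2 sqrf_eq0 mxE => /eqP.
Qed.

Lemma dot_gt0 u : u <> 0 -> 0 < dot u u.
Proof.
by move=> u0; rewrite lt0r dot_ge0 andbT; apply/eqP => /dot_eq0.
Qed.

Definition norm u : R := Num.sqrt (dot u u).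

Lemma norm_ge0 u : 0 <= norm u. Proof. exact: sqrtr_ge0. Qed.

Lemma sqr_norm u : norm u ^+ 2 = dot u u.
Proof. by rewrite sqr_sqrtr ?dot_ge0. Qed.

Lemma norm_gt0 u : u <> 0 -> 0 < norm u.
Proof. by move=> /dot_gt0 u0; rewrite sqrtr_gt0. Qed.

Lemma normN u : norm (- u) = norm u.
Proof. by rewrite /norm dotNl dotNr opprK. Qed.

Lemma cauchy_schwarz u v : `|dot u v| <= norm u * norm v.
Proof.
have key w : dot w w * dot v v - dot w v ^+ 2 >= 0.
  have [v0|v0] := eqVneq (dot v v) 0.
    by rewrite (dot_eq0 v0) -[0 : 'rV_d](subrr 0) !dotE; lra.
  have vgt0 : 0 < dot v v by rewrite lt0r v0 dot_ge0.
  have := dot_ge0 (dot v v *: w - dot w v *: v).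
  rewrite !dotE (dotC v w) => H.
  rewrite -(pmulr_rge0 _ vgt0); apply: le_trans H _.
  by rewrite le_eqVlt; apply/orP; left; apply/eqP; ring.
rewrite -ler_sqr ?nnegrE ?mulr_ge0 ?norm_ge0 // exprMn !sqr_norm real_normK ?num_real //.
by rewrite -subr_ge0 key.
Qed.

Definition unit_vec u : 'rV[R]_d := (norm u)^-1 *: u.

Lemma scale_unit_vec u : u <> 0 -> norm u *: unit_vec u = u.
Proof. by move=> /norm_gt0 u0; rewrite scalerA divff ?scale1r ?gt_eqF. Qed.

Lemma dot_unit_vec u : u <> 0 -> dot (unit_vec u) (unit_vec u) = 1.
Proof.
by move=> /norm_gt0 u0; rewrite !dotE -sqr_norm mulrA -expr2 -exprMn mulVf ?expr1n // gt_eqF.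
Qed.

Lemma norm_unit_vec u : u <> 0 -> norm (unit_vec u) = 1.
Proof. by move=> u0; rewrite /norm dot_unit_vec // sqrtr1. Qed.

End EuclideanSpace.

Section Ramsey.
Variables (T : eqType) (C : finType).
Implicit Types (s t : seq T) (col : T -> T -> C).

Lemma pigeonhole_count (S : Type) (f : S -> C) (s : seq S) m :
  (#|C| * m < size s)%N -> exists c, (m < count (fun x => f x == c) s)%N.
Proof.
move=> ms; apply/existsP/contraT; rewrite negb_exists => /forallP cm.
suff : (size s <= #|C| * m)%N by rewrite leqNgt ms.
have -> : size s = (\sum_c count (fun x => f x == c) s)%N.
  elim: s {ms cm} => [|x s IHs] /=; first by rewrite big1.
  rewrite big_split /= -IHs (bigD1 (f x)) //= eqxx big1 // => c.
  by rewrite eq_sym => /negbTE ->.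
rewrite -sum_nat_const; apply: leq_sum => c _; by rewrite leqNgt cm.
Qed.

Lemma end_homogeneous_subseq n : exists N, forall s col, (N <= size s)%N ->
  exists t : seq (T * C), [/\ size t = n, subseq (unzip1 t) s &
    pairwise (fun x y => col x.1 y.1 == x.2) t].
Proof.
elim: n => [|n [N IHn]]; first by exists 0%N => s col _; exists [::]; rewrite sub0seq.
exists (#|C| * N).+2 => -[|x s] col //=; rewrite !ltnS => sN.
have [c cN] := pigeonhole_count (col x) sN.
have := IHn [seq y <- s | col x y == c] col.
rewrite size_filter => /(_ (ltnW cN)) [t [tn ts tp]].
exists ((x, c) :: t); split => /=; first by rewrite tn.
  by rewrite eqxx; exact: subseq_trans ts (filter_subseq _ _).
rewrite tp andbT; apply/allP => y yt /=.
have : y.1 \in unzip1 t by apply: map_f.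
by move/(mem_subseq ts); rewrite mem_filter => /andP[].
Qed.

Lemma ramsey_pairs m : exists N, forall s col, (N <= size s)%N ->
  exists c t, [/\ size t = m, subseq t s & pairwise (fun x y => col x y == c) t].
Proof.
have [N HN] := end_homogeneous_subseq (#|C| * m).+1.
exists N => s col sN; have [t [tn ts tp]] := HN s col sN.
have [|c cm] := @pigeonhole_count _ (fun x : T * C => x.2) t m; first by rewrite tn.
pose t' := [seq x <- t | x.2 == c].
exists c, (take m (unzip1 t')); split.
- by rewrite size_takel // size_map size_filter ltnW.
- apply: subseq_trans (take_subseq _ _) _; apply: subseq_trans ts.
  by apply: map_subseq; apply: filter_subseq.
- apply: subseq_pairwise (take_subseq _ _) _; rewrite pairwise_map.
  have : pairwise (fun x y => col x.1 y.1 == x.2) t' by apply: pairwise_filter.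
  have : all (fun x => x.2 == c) t' by apply: filter_all.
  elim: t' => //= x t' IH /andP[/eqP xc ct] /andP[xt tt].
  by rewrite IH // andbT; move: xt; rewrite xc.
Qed.
End Ramsey.

Section Directions.
Context {R : realType} {d : nat}.
Implicit Types u v w : 'rV[R]_d.
Local Open Scope ring_scope.

Lemma entry_le_norm u i : `|u 0 i| <= norm u.
Proof.
rewrite -ler_sqr ?nnegrE ?norm_ge0 // sqr_norm real_normK ?num_real //.
rewrite /dot (bigD1 i) //= -expr2 lerDl; apply: sumr_ge0 => j _.
by rewrite -expr2 sqr_ge0.
Qed.

Definition grid_cell K u : {ffun 'I_d -> 'I_(2 * K).+1} :=
  [ffun i => inord (Num.truncn (K%:R * (u 0 i + 1)))].

Lemma same_cell_entry (K : nat) u v i : (0 < K)%N -> norm u = 1 -> norm v = 1 ->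
  grid_cell K u = grid_cell K v -> `|u 0 i - v 0 i| <= K%:R^-1.
Proof.
move=> K0 u1 v1 /ffunP /(_ i); rewrite !ffunE => /(congr1 val).
have K0' : 0 < K%:R :> R by rewrite ltr0n.
have bnd w : norm w = 1 -> 0 <= K%:R * (w 0 i + 1) /\
    (Num.truncn (K%:R * (w 0%R i + 1))%R < (2 * K).+1)%N.
  move=> w1; have := entry_le_norm w i; rewrite w1 ler_norml => /andP[wl wu].
  have w0 : 0 <= K%:R * (w 0 i + 1) by rewrite mulr_ge0 // ?ler0n //; lra.
  split=> //; rewrite ltnS -(ler_nat R).
  have /andP[+ _] := truncn_itv w0.
  by move=> /le_trans; apply; rewrite natrM mulrC ler_pM2r //; lra.
have [u0 ub] := bnd u u1; have [v0 vb] := bnd v v1.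
rewrite /= !inordK // => E.
have /andP[ul uu] := truncn_itv u0; have /andP[vl vu] := truncn_itv v0.
rewrite {}E in ul uu.
rewrite -(ler_pM2l K0') divff ?gt_eqF // -{1}(ger0_norm (ltW K0')) -normrM ler_norml.
rewrite -natr1 in uu vu; apply/andP; split; lra.
Qed.

Lemma same_cell_norm M u v : (0 < M)%N -> norm u = 1 -> norm v = 1 ->
  grid_cell (d.+1 * M) u = grid_cell (d.+1 * M) v -> norm (u - v) <= M%:R^-1.
Proof.
move=> M0 u1 v1 E.
have K0 : (0 < d.+1 * M)%N by rewrite muln_gt0.
have M0' : 0 < M%:R :> R by rewrite ltr0n.
rewrite -ler_sqr ?nnegrE ?norm_ge0 ?invr_ge0 ?ler0n // sqr_norm.
have : dot (u - v) (u - v) <= \sum_(i < d) ((d.+1 * M)%:R^-1) ^+ 2.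
  apply: ler_sum => i _; rewrite -expr2 -real_normK ?num_real //.
  rewrite ler_sqr ?nnegrE ?invr_ge0 ?ler0n // !mxE.
  exact: same_cell_entry.
move=> /le_trans; apply.
rewrite sumr_const card_ord natrM invfM exprMn -mulrnAl.
rewrite ler_piMl ?sqr_ge0 // -mulr_natl expr2 mulrA.
rewrite !ler_pdivrMr ?ltr0n // mul1r -natrM ler_nat.
by rewrite (leq_trans (leqnSn d)) // leq_pmulr.
Qed.

Lemma close_directions_subseq M m : (0 < M)%N -> exists N, forall s : seq 'rV[R]_d,
  uniq s -> (N <= size s)%N -> exists t, [/\ size t = m, subseq t s &
    forall a b c e, (a < b < m)%N -> (c < e < m)%N ->
      norm (unit_vec (t`_b - t`_a) - unit_vec (t`_e - t`_c)) <= M%:R^-1].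
Proof.
move=> M0.
have [N HN] := ramsey_pairs 'rV[R]_d {ffun 'I_d -> 'I_(2 * (d.+1 * M)).+1} m.
exists N => s us sN.
have [c [t [tm ts /(pairwiseP 0) tc]]] := HN s (fun x y => grid_cell (d.+1 * M) (unit_vec (y - x))) sN.
have ut := subseq_uniq ts us.
exists t; split => // a b a' b' /andP[ab bm] /andP[ab' bm'].
have ne i j : (i < j < m)%N -> t`_j - t`_i <> 0.
  move=> /andP[ij jm] /subr0_eq /eqP; rewrite nth_uniq ?tm // ?(ltn_trans ij) //.
  by rewrite gtn_eqF.
apply: same_cell_norm => //; rewrite ?norm_unit_vec //; try by apply: ne; apply/andP.
have /eqP -> := tc _ _ (ltn_trans ab (etrans (congr1 _ tm) bm)) (etrans (congr1 _ tm) bm) ab.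
by have /eqP -> := tc _ _ (ltn_trans ab' (etrans (congr1 _ tm) bm')) (etrans (congr1 _ tm) bm') ab'.
Qed.

End Directions.

Section Pencil.
Context {R : realType} {d : nat}.
Variables (M : nat) (X : nat -> 'rV[R]_d) (Q : 'rV[R]_d -> Prop).
Local Open Scope ring_scope.
Let L := (2 * M ^ 2)%N.
Let S a b := norm (X b - X a).
Let U a b := unit_vec (X b - X a).
Hypothesis M2 : (2 <= M)%N.
Hypothesis X_inj : forall a b, (a < b <= L)%N -> X b - X a <> 0.
Hypothesis X_close : forall a b c e, (a < b <= L)%N -> (c < e <= L)%N ->
  norm (U a b - U c e) <= M%:R^-1.
Hypothesis XQ : forall a b q, (a <= L)%N -> (b <= L)%N -> Q q ->
  0 <= dot (X b - X a) (q - X a).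
Hypothesis QX : forall a q q', (a <= L)%N -> Q q -> Q q' ->
  0 <= dot (q' - q) (X a - q).

Let Minv : 0 < M%:R^-1 :> R.
Proof. by rewrite invr_gt0 ltr0n (leq_trans _ M2). Qed.

Let Minv2 : M%:R^-1 <= 2^-1 :> R.
Proof. by rewrite lef_pV2 ?posrE ?ltr0n ?(leq_trans _ M2) // ler_nat. Qed.

Let L8 : (8 <= L)%N.
Proof. by rewrite /L (leq_mul2l 2 4) /= (@leq_exp2r 2 M 2). Qed.

Let S_gt0 a b : (a < b <= L)%N -> 0 < S a b.
Proof. by move=> /X_inj; exact: norm_gt0. Qed.

Let SU a b : (a < b <= L)%N -> X b - X a = S a b *: U a b.
Proof. by move=> /X_inj ab; rewrite scale_unit_vec. Qed.

Let UU a b : (a < b <= L)%N -> dot (U a b) (U a b) = 1.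
Proof. by move=> /X_inj ab; rewrite dot_unit_vec. Qed.

Let dSl a b v : dot (S a b *: U a b) v = S a b * dot (U a b) v.
Proof. exact: dotZl. Qed.

Let dSr a b v : dot v (S a b *: U a b) = S a b * dot v (U a b).
Proof. exact: dotZr. Qed.

Let U_between a b q : (a < b <= L)%N -> Q q ->
  0 <= dot (U a b) (q - X a) <= S a b.
Proof.
move=> ab Qq; have S0 := S_gt0 ab.
have [aL bL] : (a <= L)%N /\ (b <= L)%N.
  by case/andP: ab => ab bL; split=> //; apply: ltnW; apply: leq_trans bL.
have := XQ aL bL Qq; have := XQ bL aL Qq.
have -> : q - X b = q - X a - (X b - X a) by rewrite opprB addrA subrK.
rewrite -[X a - X b]opprB SU // dotNl dotBr !dSl dSr UU // => H1 H2.
rewrite -(pmulr_rge0 _ S0) H2 /= -(ler_pM2l S0); lra.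
Qed.

Let U_obtuse a b c e : (a < b <= L)%N -> (c < e <= L)%N ->
  2^-1 <= dot (U a b) (U c e).
Proof.
move=> ab ce; have := X_close ab ce.
rewrite -[_ <= M%:R^-1]ler_sqr ?nnegrE ?norm_ge0 ?(ltW Minv) // sqr_norm dotBl !dotBr !UU //.
rewrite [dot (U c e) _]dotC.
have : (M%:R^-1) ^+ 2 <= (2^-1) ^+ 2 :> R by rewrite ler_sqr ?nnegrE ?(ltW Minv) ?invr_ge0.
lra.
Qed.

Let U_change a b c e v : (a < b <= L)%N -> (c < e <= L)%N ->
  `|dot (U c e) v| <= `|dot (U a b) v| + M%:R^-1 * norm v.
Proof.
move=> ab ce.
have -> : dot (U c e) v = dot (U a b) v + dot (U c e - U a b) v by rewrite dotBl; ring.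
apply: le_trans (ler_normD _ _) _; rewrite lerD2l.
apply: le_trans (cauchy_schwarz _ _) _; rewrite ler_wpM2r ?norm_ge0 //.
exact: X_close.
Qed.

Let lt_L a b : (a < b <= 8)%N -> (a < b <= L)%N.
Proof. by case/andP=> ab b8; rewrite ab (leq_trans b8). Qed.

(* The projections of [q] to the lines through X 0, X 1 and through X 2, X 3
   lie before X 1 and after X 2 respectively; as the lines are almost parallel,
   [q] has to be far away. *)
Lemma pencil_apex_almost_orthogonal q : Q q ->
  `|dot (U 0 1) (q - X 1)| <= 3 * M%:R^-1 * norm (q - X 1).
Proof.
move=> Qq.
have i01 : (0 < 1 <= L)%N by exact: lt_L.
have i12 : (1 < 2 <= L)%N by exact: lt_L.
have i23 : (2 < 3 <= L)%N by exact: lt_L.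
have /andP[_ A01] := U_between i01 Qq.
have /andP[A12 B12] := U_between i12 Qq.
have /andP[A23 _] := U_between i23 Qq.
have C23 := U_obtuse i23 i12.
have E01 : q - X 0%N = q - X 1%N + (X 1%N - X 0%N) by rewrite addrA subrK.
have E23 : q - X 2%N = q - X 1%N - (X 2%N - X 1%N) by rewrite opprB addrA subrK.
rewrite E01 dotDr (SU i01) dSr UU // in A01.
rewrite E23 dotBr (SU i12) dSr in A23.
have D : dot (U 2 3 - U 0 1) (q - X 1%N) <= M%:R^-1 * norm (q - X 1%N).
  apply: le_trans (ler_norm _) _; apply: le_trans (cauchy_schwarz _ _) _.
  by rewrite ler_wpM2r ?norm_ge0 ?X_close.
rewrite dotBl in D.
have S12 : S 1 2 / 2 <= M%:R^-1 * norm (q - X 1%N).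
  have : S 1 2 / 2 <= S 1 2 * dot (U 2 3) (U 1 2) by rewrite ler_pM2l // S_gt0.
  lra.
have := U_change (q - X 1%N) i12 i01.
rewrite (ger0_norm A12); lra.
Qed.

Let small_gap : exists2 a, (a < L)%N & L%:R * S a a.+1 <= 2 * S 0 L.
Proof.
have i01 : (0 < 1 <= L)%N by exact: lt_L.
have L0 : (0 < L)%N by exact: leq_trans L8.
have i0L : (0 < L <= L)%N by rewrite L0 /=.
have [[a aL]|no_gap] := pselect (exists2 a, (a < L)%N & L%:R * S a a.+1 <= 2 * S 0 L).
  by exists a.
suff H a : (a.+1 <= L)%N -> a.+1%:R * S 0 L < L%:R * dot (U 0 1) (X a.+1 - X 0).
  have := H L.-1; rewrite prednK // => /(_ (leqnn _)); rewrite ltr_pM2l ?ltr0n //.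
  move/lt_le_trans => /(_ (norm (U 0 1) * S 0 L)); rewrite norm_unit_vec; last exact: X_inj.
  rewrite mul1r ltxx => H'; exfalso; apply/notF/H'.
  apply: le_trans (ler_norm _) _; apply: le_trans (cauchy_schwarz _ _) _.
  by rewrite norm_unit_vec ?mul1r //; exact: X_inj.
have step b : (b < L)%N -> S 0 L < L%:R * dot (U 0 1) (X b.+1 - X b).
  move=> bL; have ib : (b < b.+1 <= L)%N by rewrite ltnSn bL.
  have : 2 * S 0 L < L%:R * S b b.+1.
    by rewrite ltNge; apply/negP => ?; apply: no_gap; exists b.
  have := U_obtuse i01 ib; rewrite (SU ib) dSr => ho.
  have LS : 0 < L%:R * S b b.+1 by rewrite mulr_gt0 ?S_gt0 ?ltr0n.
  move: ho; rewrite -(ler_pM2l LS) mulrA => h1 h2.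
  by apply: lt_le_trans h1; rewrite ltr_pdivlMr // mulrC.
elim: a => [|a IHa] aL; first by rewrite mul1r; exact: step.
have h1 := IHa (ltnW aL); have h2 := step _ aL.
rewrite -[X a.+2 - X 0](subrKA (X a.+1)) dotDr -(natr1 a.+1).
by rewrite mulrDl mul1r mulrDr addrC; apply: ltrD.
Qed.

(* If |q' - q| is small compared with X 0 X L, orthogonality comes from the
   slabs of pairs (q, X a); otherwise |q' - q| is large compared with some
   X a X a.+1, and it comes from the slabs of pairs (X a, q). *)
Lemma pencil_almost_orthogonal q q' : Q q -> Q q' ->
  `|dot (U 0 1) (q' - q)| <= 3 * M%:R^-1 * norm (q' - q).
Proof.
move=> Qq Qq'.
have i01 : (0 < 1 <= L)%N by exact: lt_L.
have L0 : (0 < L)%N by exact: leq_trans L8.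
have i0L : (0 < L <= L)%N by rewrite L0 /=.
set w := q' - q; have w0 := norm_ge0 w.
have suffU a b : (a < b <= L)%N -> `|dot (U a b) w| <= M%:R^-1 * norm w ->
    `|dot (U 0 1) w| <= 3 * M%:R^-1 * norm w.
  move=> ab Hab; have := U_change w ab i01.
  have := mulr_ge0 (ltW Minv) w0; lra.
have [wS|wS] := lerP (M%:R * norm w) (S 0 L).
  apply: (suffU _ _ i0L); rewrite -(ler_pM2l (S_gt0 i0L)).
  have bnd a : (a <= L)%N -> 0 <= dot w (X a - q) <= norm w ^+ 2.
    move=> aL; have := QX aL Qq Qq'; have := QX aL Qq' Qq.
    rewrite -/w -[q - q']opprB -/w => + ->.
    have -> : X a - q' = X a - q - w by rewrite /w opprB addrA subrK.
    by rewrite dotNl dotBr sqr_norm oppr_ge0 subr_le0.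
  have /andP[A1 A2] := bnd _ (leq0n L); have /andP[B1 B2] := bnd _ (leqnn L).
  have : `|dot w (X L - X 0)| <= norm w ^+ 2.
    have -> : X L - X 0%N = (X L - q) - (X 0%N - q) by rewrite opprB addrA subrK.
    by rewrite dotBr ler_norml; apply/andP; split; lra.
  rewrite (SU i0L) dSr normrM (ger0_norm (ltW (S_gt0 i0L))) [dot w _]dotC.
  move=> /le_trans; apply.
  rewrite expr2 mulrCA mulrA ler_wpM2r //.
  by rewrite -ler_pdivrMl ?invrK // ltW.
have [a aL gap] := small_gap.
have ia : (a < a.+1 <= L)%N by rewrite ltnSn aL.
apply: (suffU _ _ ia).
have /andP[A1 A2] := U_between ia Qq; have /andP[B1 B2] := U_between ia Qq'.
have : `|dot (U a a.+1) w| <= S a a.+1.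
  have -> : w = (q' - X a) - (q - X a) by rewrite /w opprB addrA subrK.
  by rewrite dotBr ler_norml; apply/andP; split; lra.
move=> /le_trans; apply.
have M0 : 0 < M%:R :> R by rewrite ltr0n (leq_trans _ M2).
rewrite -(ler_pM2l M0) mulrA divff ?gt_eqF // mul1r -(ler_pM2l M0).
move: gap; rewrite /L natrM natrX; lra.
Qed.

End Pencil.

Section AlmostOrthogonalDirections.
Context {R : realType} {d : nat}.
Local Open Scope ring_scope.

Lemma contains_multipartite_leq (T : Type) (G : T -> T -> Prop) (k n r : nat) :
  (k <= n)%N -> contains_subgraph G (@complete_multipartite n r) ->
  contains_subgraph G (@complete_multipartite k r).
Proof.
move=> kn [f [finj fG]].
exists (fun x => f (widen_ord kn x.1, x.2)); split.
  by move=> [i a] [j b] /finj [/= /ord_inj -> ->].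
move=> [i a] [j b] /= ij; apply: fG => /= /(congr1 val) /= /ord_inj; exact: ij.
Qed.

Lemma multipartite_almost_orthogonal (k M : nat) : (2 <= M)%N ->
  (forall r, exists V : {fset 'rV[R]_d},
    contains_subgraph (@dn_graph R d V) (@complete_multipartite k r)) ->
  exists p u : 'I_k -> 'rV[R]_d,
  [/\ forall i j, i != j -> p i <> p j,
      forall a b c, a != b -> c != b -> 0 <= dot (p a - p b) (p c - p b),
      forall i, dot (u i) (u i) = 1,
      forall i j, i != j -> `|dot (u i) (u j)| <= 3 * M%:R^-1 &
      forall i a b, `|dot (u i) (p a - p b)| <= 3 * M%:R^-1 * norm (p a - p b)].
Proof.
move=> M2 HV; have M0 : (0 < M)%N by exact: leq_trans M2.
pose L := (2 * M ^ 2)%N.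
have L1 : (1 < L)%N by rewrite /L (leq_trans (_ : 2 <= 2 * 2 ^ 2)%N) // leq_mul2l leq_exp2r.
have [N HN] := @close_directions_subseq R d M L.+1 M0.
have [V [f [finj fV]]] := HV N.
pose P i a := val (f (i, a)).
have Pslab i j a b i' a' : i != j -> 0 <= dot (P i' a' - P i a) (P j b - P i a).
  move=> /eqP ij; have [_ /(_ (P i' a') (valP (f (i', a'))))] := fV (i, a) (j, b) ij.
  by case.
have /fin_all_exists [t Ht] : forall i, exists t : seq 'rV[R]_d, [/\ size t = L.+1,
    subseq t [seq P i a | a <- enum 'I_N] &
    forall a b c e, (a < b < L.+1)%N -> (c < e < L.+1)%N ->
      norm (unit_vec (t`_b - t`_a) - unit_vec (t`_e - t`_c)) <= M%:R^-1].
  move=> i; apply: HN; last by rewrite size_map size_enum_ord.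
  rewrite map_inj_uniq ?enum_uniq // => a b /val_inj /finj [] //.
have tP i a : (a <= L)%N -> exists a', (t i)`_a = P i a'.
  move=> aL; have [ti ts _] := Ht i.
  have /(mem_subseq ts) /mapP[a' _ ->] : (t i)`_a \in t i by rewrite mem_nth // ti.
  by exists a'.
have tinj i a b : (a < b <= L)%N -> (t i)`_b - (t i)`_a <> 0.
  move=> /andP[ab bL] /subr0_eq /eqP; have [ti ts _] := Ht i.
  rewrite nth_uniq ?ti ?ltnS ?(ltnW (leq_trans ab bL)) ?gtn_eqF //.
  apply: subseq_uniq ts _.
  by rewrite map_inj_uniq ?enum_uniq // => x y /val_inj /finj [].
pose Q i q := exists j b, j != i /\ q = P j b.
have tclose i a b c e : (a < b <= L)%N -> (c < e <= L)%N ->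
    norm (unit_vec ((t i)`_b - (t i)`_a) - unit_vec ((t i)`_e - (t i)`_c)) <= M%:R^-1.
  by have [_ _] := Ht i; apply.
have tQ i a b q : (a <= L)%N -> (b <= L)%N -> Q i q ->
    0 <= dot ((t i)`_b - (t i)`_a) (q - (t i)`_a).
  move=> /(tP i) [a' ->] /(tP i) [b' ->] [j [c [ji ->]]].
  by apply: Pslab; rewrite eq_sym.
have Qt i a q q' : (a <= L)%N -> Q i q -> Q i q' -> 0 <= dot (q' - q) ((t i)`_a - q).
  by move=> /(tP i) [a' ->] [j [c [ji ->]]] [j' [c' [ji' ->]]]; apply: Pslab.
have main1 i := pencil_apex_almost_orthogonal M2 (@tinj i) (@tclose i) (@tQ i).
have main2 i := pencil_almost_orthogonal M2 (@tinj i) (@tclose i) (@tQ i) (@Qt i).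
have Q01 i j a : (a <= L)%N -> i != j -> Q i (t j)`_a.
  by move=> aL ij; have [a' ->] := tP j a aL; exists j, a'; rewrite eq_sym.
have i01 : (0 < 1 <= L)%N by exact: ltnW.
have L1' := ltnW L1.
exists (fun i => (t i)`_1), (fun i => unit_vec ((t i)`_1 - (t i)`_0)); split.
- move=> i j ij; have [a' ->] := tP i 1%N L1'; have [b' ->] := tP j 1%N L1'.
  by move=> /val_inj /finj [ij' _]; rewrite ij' eqxx in ij.
- move=> a b c ab cb; have [a' ->] := tP a 1%N L1'; have [b' ->] := tP b 1%N L1'.
  by have [c' ->] := tP c 1%N L1'; apply: Pslab; rewrite eq_sym.
- by move=> i; rewrite dot_unit_vec //; exact: tinj.
- move=> i j ij; have := main2 i _ _ (Q01 i j 0%N (leq0n _) ij) (Q01 i j 1%N L1' ij).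
  rewrite [X in _ -> `|dot _ X| <= _]/unit_vec dotZr normrM.
  have n0 := norm_gt0 (@tinj j _ _ i01).
  by rewrite ger0_norm ?invr_ge0 ?norm_ge0 // ler_pdivrMl // mulrC => /le_trans; apply; rewrite mulrC.
- move=> i a b; have [->|bi] := eqVneq b i; have [->|ai] := eqVneq a i.
  + by rewrite subrr /norm -(subrr (0 : 'rV_d)) !dotE !subrr normr0 sqrtr0 mulr0.
  + by apply: main1; apply: Q01; rewrite // eq_sym.
  + rewrite -(opprB (t b)`_1) dotNr normrN normN.
    by apply: main1; apply: Q01; rewrite // eq_sym.
  + by apply: main2; apply: Q01; rewrite // eq_sym.
Qed.

End AlmostOrthogonalDirections.

Section AlmostOrthonormalFrames.
Context {R : realType} {d : nat}.
Implicit Types v w : 'rV[R]_d.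
Local Open Scope ring_scope.

Lemma dot_mulmx v w : dot v w = (v *m w^T) 0 0.
Proof. by rewrite mxE; apply: eq_bigr => i _; rewrite mxE. Qed.

Lemma norm_mulmx_le v (C : 'M[R]_d) : norm (v *m C) ^+ 2 <= norm v ^+ 2 * \tr (C *m C^T).
Proof.
rewrite mxtrace_mulC /mxtrace mulr_sumr sqr_norm; apply: ler_sum => j _.
have -> : (v *m C) 0 j = dot v (col j C)^T.
  by rewrite mxE; apply: eq_bigr => i _; rewrite !mxE.
have -> : (C^T *m C) j j = norm (col j C)^T ^+ 2.
  by rewrite sqr_norm mxE; apply: eq_bigr => i _; rewrite !mxE.
rewrite -expr2 -exprMn -[leLHS]real_normK ?num_real // ler_sqr ?nnegrE ?mulr_ge0 ?norm_ge0 //.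
exact: cauchy_schwarz.
Qed.

(* With G the matrix with rows g i, the Frobenius norms of [G^T *m G - 1] and
   [G *m G^T - 1] are equal, and the latter involves the given scalar products
   only. *)
Lemma almost_orthonormal_dot (g : 'I_d -> 'rV[R]_d) (e : R) : 0 <= e ->
  (forall i j, `|dot (g i) (g j) - (i == j)%:R| <= e) ->
  forall v w, `|dot v w - \sum_i dot v (g i) * dot w (g i)| <= d%:R * e * norm v * norm w.
Proof.
move=> e0 ge v w; pose G := \matrix_i g i.
have -> : dot v w - \sum_i dot v (g i) * dot w (g i) = - dot (v *m (G^T *m G - 1%:M)) w.
  rewrite (dot_mulmx (v *m _)) mulmxBr mulmx1 mulmxBl.
  rewrite -[LHS]opprK opprB; congr (- _); rewrite [RHS]mxE [X in _ = _ + X]mxE -(dot_mulmx v w).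
  congr (_ - _); rewrite mulmxA -mulmxA [RHS]mxE; apply: eq_bigr => i _.
  rewrite !mxE; congr (_ * _); apply: eq_bigr => j _; rewrite !mxE //.
  by rewrite mulrC.
have trE : \tr ((G^T *m G - 1%:M) *m (G^T *m G - 1%:M)^T) <= (d%:R * e) ^+ 2.
  have -> : (G^T *m G - 1%:M)^T = G^T *m G - 1%:M.
    by rewrite linearB /= trmx_mul trmxK trmx1.
  have -> : \tr ((G^T *m G - 1%:M) *m (G^T *m G - 1%:M)) =
      \tr ((G *m G^T - 1%:M) *m (G *m G^T - 1%:M)).
    rewrite !mulmxBl !mulmxBr !mul1mx !mulmx1 !raddfB /=.
    by rewrite [\tr (G^T *m G)]mxtrace_mulC [\tr (_ *m _ *m _)]mxtrace_mulC !mulmxA mxtrace_mulC !mulmxA.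
  have : \tr ((G *m G^T - 1%:M) *m (G *m G^T - 1%:M)) <= \sum_(i < d) \sum_(j < d) e ^+ 2.
    apply: ler_sum => i _; rewrite mxE; apply: ler_sum => j _.
    have H a b : (G *m G^T - 1%:M) a b = dot (g a) (g b) - (a == b)%:R.
      by rewrite !mxE; congr (_ - _); apply: eq_bigr => l _; rewrite !mxE.
    rewrite !H (dotC (g j)) (eq_sym j) -expr2 -real_normK ?num_real //.
    by rewrite ler_sqr ?nnegrE.
  move=> /le_trans; apply; rewrite !sumr_const !card_ord -mulrnA -[leLHS]mulr_natl natrM.
  by rewrite exprMn -expr2.
rewrite normrN; apply: le_trans (cauchy_schwarz _ _) _.
rewrite ler_wpM2r ?norm_ge0 // mulrC.
rewrite -ler_sqr ?nnegrE ?norm_ge0 ?mulr_ge0 ?ler0n ?norm_ge0 //.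
apply: le_trans (norm_mulmx_le _ _) _; rewrite exprMn.
by rewrite ler_wpM2l ?sqr_ge0.
Qed.

End AlmostOrthonormalFrames.

Section Complement.
Context {R : realType} {k e : nat}.
Local Open Scope ring_scope.

Lemma almost_orthogonal_complement (u : 'I_k -> 'rV[R]_(k + e)) (f : 'I_e -> 'rV[R]_(k + e))
    (c : R) v w : 0 <= c <= 1 ->
  (forall i, dot (u i) (u i) = 1) ->
  (forall i j, i != j -> `|dot (u i) (u j)| <= c) ->
  (forall i j, `|dot (u i) (f j)| <= c) ->
  (forall i j, dot (f i) (f j) = (i == j)%:R) ->
  (forall i, `|dot (u i) v| <= c * norm v) ->
  (forall i, `|dot (u i) w| <= c * norm w) ->
  `|dot v w - \sum_i dot v (f i) * dot w (f i)| <= (k + e + k)%:R * c * norm v * norm w.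
Proof.
move=> /andP[c0 c1] uu uc uf ff uv uw.
pose g i := match split i with inl a => u a | inr b => f b end.
have := @almost_orthonormal_dot _ _ g c c0 _ v w.
have gl a : g (lshift e a) = u a by rewrite /g -[lshift e a]/(unsplit (inl a)) unsplitK.
have gr b : g (rshift k b) = f b by rewrite /g -[rshift k b]/(unsplit (inr b)) unsplitK.
have /[swap] /[apply] : forall i j, `|dot (g i) (g j) - (i == j)%:R| <= c.
  move=> i j; rewrite -(splitK i) -(splitK j).
  case: (split i) => a; case: (split j) => b; rewrite /= ?gl ?gr.
  - have [->|ab] := eqVneq a b; first by rewrite uu eqxx subrr normr0.
    by rewrite (inj_eq (@lshift_inj _ _)) (negbTE ab) subr0 uc.
  - by rewrite eq_lrshift subr0 uf.
  - by rewrite eq_rlshift subr0 dotC uf.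
  - by rewrite ff (inj_eq (@rshift_inj _ _)) subrr normr0.
rewrite big_split_ord /= opprD addrA.
under eq_bigr do rewrite gl; under [X in _ - X]eq_bigr do rewrite gr.
set s := \sum_(i < k) _; set t := \sum_(i < e) _ => H.
have sle : `|s| <= k%:R * c * norm v * norm w.
  apply: le_trans (ler_norm_sum _ _ _) _.
  have -> : k%:R * c * norm v * norm w = \sum_(i < k) (c * norm v * norm w).
    by rewrite sumr_const card_ord -[RHS]mulr_natl !mulrA.
  apply: ler_sum => i _; rewrite normrM dotC (dotC w).
  apply: le_trans (ler_pM _ _ (uv i) (uw i)) _ => //.
  have -> : c * norm v * (c * norm w) = c * (c * norm v * norm w) by ring.
  by rewrite ler_piMl ?mulr_ge0 ?norm_ge0.
have -> : dot v w - t = dot v w - s - t + s by ring.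
apply: le_trans (ler_normD _ _) _.
by rewrite natrD !mulrDl; apply: lerD.
Qed.
End Complement.

Section AlmostUnitVectors.
Context {R : realType}.
Local Open Scope ring_scope.
Implicit Types x y z : R.

Definition almost_unit x y : Prop :=
  99 / 100 <= x ^+ 2 + y ^+ 2 /\ x ^+ 2 + y ^+ 2 <= 101 / 100.

Lemma almost_unit_bound x y : almost_unit x y -> -(101 / 100) <= x <= 101 / 100.
Proof.
move=> [_ H]; have y0 := sqr_ge0 y; rewrite -ler_norml -ler_sqr ?nnegrE //.
  by rewrite real_normK ?num_real //; lra.
by lra.
Qed.

Lemma almost_unitC x y : almost_unit x y -> almost_unit y x.
Proof. by rewrite /almost_unit addrC. Qed.

Lemma almost_unitNl x y : almost_unit x y -> almost_unit (- x) y.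
Proof. by rewrite /almost_unit sqrrN. Qed.

Lemma almost_unitNr x y : almost_unit x y -> almost_unit x (- y).
Proof. by rewrite /almost_unit sqrrN. Qed.

Lemma almost_unit_large x y c : almost_unit x y -> 0 <= c <= 1 / 10 ->
  - c <= y <= c -> - c <= x -> 98 / 100 <= x.
Proof.
move=> [H _] /andP[c0 c1] /andP[y1 y2] x0.
have cy : 0 <= (c - y) * (y + c) by apply: mulr_ge0; lra.
have cc : 0 <= (1 / 10 - c) * (1 / 10 + c) by apply: mulr_ge0; lra.
rewrite leNgt; apply/negP => xs.
have : 0 <= (98 / 100 - x) * (x + 1 / 10) by apply: mulr_ge0; lra.
lra.
Qed.

Lemma almost_vertical x1 x2 z1 z2 d1 d2 y1 y2 :
  almost_unit x1 x2 -> almost_unit z1 z2 -> almost_unit d1 d2 -> almost_unit y1 y2 ->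
  -(1 / 100) <= x1 -> 0 <= x2 -> z1 <= 1 / 100 -> 0 <= z2 -> 0 <= d1 -> 0 <= d2 ->
  x1 * d1 + x2 * d2 <= 1 / 100 -> z1 * d1 + z2 * d2 <= 1 / 100 ->
  -(1 / 100) <= x1 * z1 + x2 * z2 -> -(1 / 100) <= y1 * d1 + y2 * d2 ->
  x1 <= 5 / 100 /\ - y1 <= 5 / 100.
Proof.
move=> ux uz ud uy x1l x2l z1u z2l d1l d2l xd zd xz yd.
have [/andP[_ d1u] [udl _]] := (almost_unit_bound ud, ud).
have /andP[_ y2u] := almost_unit_bound (almost_unitC uy).
have /andP[z1l _] := almost_unit_bound uz.
have xd1 : 0 <= (x1 + 1 / 100) * d1 by apply: mulr_ge0; clear -x1l d1l; lra.
have xd2 : 0 <= x2 * d2 by exact: mulr_ge0.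
have x2d2 : x2 * d2 <= 201 / 10000 by clear -xd xd1 d1u; lra.
have [d2h|d2h] := lerP (1 / 2) d2.
  have x2d2' : 0 <= x2 * (d2 - 1 / 2) by apply: mulr_ge0; clear -x2l d2h; lra.
  have x2u : x2 <= 5 / 100 by clear -x2d2 x2d2'; lra.
  have x1h : 98 / 100 <= x1.
    apply: (almost_unit_large (c := 1 / 20) ux); clear -x1l x2l x2u; try (apply/andP; split); lra.
  have x1d1 : 0 <= (x1 - 98 / 100) * d1 by apply: mulr_ge0; clear -x1h d1l; lra.
  have d1s : d1 <= 11 / 1000 by clear -x1d1 xd xd2; lra.
  have z2d2 : 0 <= z2 * (d2 - 1 / 2) by apply: mulr_ge0; clear -z2l d2h; lra.
  have z1d1 : 0 <= (z1 + 101 / 100) * d1 by apply: mulr_ge0; clear -z1l d1l; lra.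
  have z2u : z2 <= 5 / 100 by clear -z2d2 z1d1 zd d1s; lra.
  have z1h : 98 / 100 <= - z1.
    apply: (almost_unit_large (c := 1 / 20) (almost_unitNl uz));
      clear -z1u z2l z2u; try (apply/andP; split); lra.
  have x1z1 : 0 <= (x1 - 98 / 100) * (- z1 - 98 / 100).
    by apply: mulr_ge0; clear -x1h z1h; lra.
  have x2z2 : 0 <= (5 / 100 - x2) * z2 by apply: mulr_ge0; clear -x2u z2l; lra.
  by exfalso; clear -x1z1 x2z2 xz x1h z1h z2u; lra.
have d1h : 86 / 100 <= d1.
  have d22 : 0 <= d2 * (1 / 2 - d2) by apply: mulr_ge0; clear -d2l d2h; lra.
  rewrite leNgt; apply/negP => d1s.
  have : 0 <= d1 * (86 / 100 - d1) by apply: mulr_ge0; clear -d1l d1s; lra.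
  by clear -udl d22 d2h d1s; lra.
have x1s : x1 <= 2 / 100.
  rewrite leNgt; apply/negP => x1b.
  have : 0 <= (x1 - 2 / 100) * (d1 - 86 / 100) by apply: mulr_ge0; clear -x1b d1h; lra.
  by clear -xd xd2 x1b d1h; lra.
have x2h : 98 / 100 <= x2.
  apply: (almost_unit_large (c := 1 / 20) (almost_unitC ux));
    clear -x1l x1s x2l; try (apply/andP; split); lra.
have x2d2' : 0 <= (x2 - 98 / 100) * d2 by apply: mulr_ge0; clear -x2h d2l; lra.
have d2s : d2 <= 21 / 1000 by clear -x2d2 x2d2'; lra.
have d1hh : 98 / 100 <= d1.
  apply: (almost_unit_large (c := 1 / 20) ud);
    clear -d1h d2l d2s; try (apply/andP; split); lra.
split; first by clear -x1s; lra.
have y2d2 : 0 <= (101 / 100 - y2) * d2 by apply: mulr_ge0; clear -y2u d2l; lra.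
rewrite leNgt; apply/negP => y1b.
have : 0 <= (- y1 - 5 / 100) * (d1 - 98 / 100) by apply: mulr_ge0; clear -y1b d1hh; lra.
by clear -y1b y2d2 d2s d1hh yd; lra.
Qed.

End AlmostUnitVectors.

Section PlanarPoints.
Context {R : realType} {T : eqType}.
Local Open Scope ring_scope.

(* The points have coordinates [(a i, b i)] and distances approximately [N i j];
   all angles are at most slightly obtuse, and the points p and q are at maximal
   distance on a horizontal line. *)
Record almost_nonobtuse (a b : T -> R) (N : T -> T -> R) (p q : T) : Prop := {
  an_pos : forall i j, i != j -> 0 < N i j;
  an_sym : forall i j, N i j = N j i;
  an_diam : forall i j, N i j <= N p q;
  an_unit : forall i j, i != j -> almost_unit ((a j - a i) / N i j) ((b j - b i) / N i j);
  an_angle : forall i j l, i != j -> l != j ->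
    - (1 / 100) <= (a i - a j) / N j i * ((a l - a j) / N j l) +
                   (b i - b j) / N j i * ((b l - b j) / N j l);
  an_horizontal : b p = b q;
  an_base : a q - a p = N p q
}.

Lemma almost_nonobtuseN a b N p q :
  almost_nonobtuse a b N p q -> almost_nonobtuse a (fun i => - b i) N p q.
Proof.
move=> [H1 H2 H3 H4 H5 H6 H7]; split => //.
- by move=> i j /H4; rewrite -opprD mulNr; exact: almost_unitNr.
- by move=> i j l ij lj; rewrite -!opprD !(mulNr, mulrN) opprK; exact: H5.
- by rewrite H6.
Qed.

Variables (a b : T -> R) (N : T -> T -> R) (p q : T).
Hypothesis ab : almost_nonobtuse a b N p q.
Hypothesis pq : p != q.
Let f i j := (a j - a i) / N i j.
Let g i j := (b j - b i) / N i j.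

Let fC i j : f j i = - f i j.
Proof. by rewrite /f (an_sym ab j) -mulNr opprB. Qed.

Let gC i j : g j i = - g i j.
Proof. by rewrite /g (an_sym ab j) -mulNr opprB. Qed.

Let fpq : f p q = 1.
Proof. by rewrite /f (an_base ab) divff // gt_eqF // (an_pos ab). Qed.

Let gpq : g p q = 0.
Proof. by rewrite /g (an_horizontal ab) subrr mul0r. Qed.

Let unit_fg i j : i != j -> almost_unit (f i j) (g i j).
Proof. exact: (an_unit ab). Qed.

Let angle j i l : i != j -> l != j -> - (1 / 100) <= f j i * f j l + g j i * g j l.
Proof. exact: (an_angle ab). Qed.

Let g_ge0 i j : i != j -> b i <= b j -> 0 <= g i j.
Proof. by move=> /(an_pos ab) ij bij; rewrite divr_ge0 ?subr_ge0 // ltW. Qed.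

Let f_ge0 i j : i != j -> a i <= a j -> 0 <= f i j.
Proof. by move=> /(an_pos ab) ij aij; rewrite divr_ge0 ?subr_ge0 // ltW. Qed.

Let fp_ge x : x != p -> - (1 / 100) <= f p x.
Proof.
have qp : q != p by rewrite eq_sym.
by move=> xp; have := angle qp xp; rewrite fpq gpq; lra.
Qed.

Let fq_le x : x != q -> f q x <= 1 / 100.
Proof.
move=> xq; have := angle pq xq; rewrite (fC p q) (gC p q) fpq gpq; lra.
Qed.

Lemma two_on_one_side x y : x != p -> x != q -> y != p -> y != q -> x != y ->
  b p <= b x -> b p <= b y -> a x <= a y -> f p x <= 5 / 100 /\ - f q y <= 5 / 100.
Proof.
move=> xp xq yp yq xy bx by_ axy.
have yx : y != x by rewrite eq_sym.
have px : p != x by rewrite eq_sym.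
have qx : q != x by rewrite eq_sym.
have py : p != y by rewrite eq_sym.
have qy : q != y by rewrite eq_sym.
have bxq : b q <= b x by rewrite -(an_horizontal ab).
have byq : b q <= b y by rewrite -(an_horizontal ab).
have A1 := angle px yx; have A2 := angle qx yx; have A3 := angle px qx.
have B1 := angle py xy; have B2 := angle qy xy; have B3 := angle py qy.
rewrite (fC p) (gC p) in A1; rewrite (fC q) (gC q) in A2.
rewrite (fC p) (gC p) (fC q) (gC q) in A3.
rewrite (fC p) (gC p) (fC x) (gC x) in B1; rewrite (fC q) (gC q) (fC x) (gC x) in B2.
rewrite (fC p) (gC p) (fC q) (gC q) in B3.
have [bxy|byx] := leP (b x) (b y).
  apply: (@almost_vertical _ (f p x) (g p x) (f q x) (g q x) (f x y) (g x y) (f q y) (g q y));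
    try exact: unit_fg.
  - exact: fp_ge.
  - exact: g_ge0.
  - exact: fq_le.
  - exact: g_ge0.
  - exact: f_ge0.
  - exact: g_ge0.
  - by lra.
  - by lra.
  - by lra.
  - by lra.
rewrite -[f p x]opprK; apply and_comm.
apply: (@almost_vertical _ (- f q y) (g q y) (- f p y) (g p y) (f x y) (- g x y) (- f p x) (g p x));
  try (by apply: almost_unitNl; exact: unit_fg).
- by apply: almost_unitNr; exact: unit_fg.
- by rewrite lerN2; exact: fq_le.
- exact: g_ge0.
- by have := fp_ge yp; lra.
- exact: g_ge0.
- exact: f_ge0.
- by rewrite oppr_ge0 -oppr_ge0 -gC; apply: g_ge0 => //; apply: ltW.
- by lra.
- by lra.
- by lra.
- by lra.
Qed.

Lemma three_on_one_side_sorted x y z : uniq [:: p; q; x; y; z] ->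
  b p <= b x -> b p <= b y -> b p <= b z -> a x <= a y -> a y <= a z -> False.
Proof.
rewrite /= !inE !negb_or -!andbA => /and5P[_ px py pz] /and5P[qx qy qz xy].
move=> /and3P[xz yz _] bx by_ bz axy ayz.
have [_ fqy] : f p x <= 5 / 100 /\ - f q y <= 5 / 100.
  by apply: two_on_one_side; rewrite // eq_sym.
have [fpy _] : f p y <= 5 / 100 /\ - f q z <= 5 / 100.
  by apply: two_on_one_side; rewrite // eq_sym.
have Npy := an_pos ab py; have Nqy := an_pos ab qy; have Npq := an_pos ab pq.
have dpy := an_diam ab p y; have dqy := an_diam ab q y; have base := an_base ab.
have E1 : a y - a p <= 5 / 100 * N p y by rewrite -ler_pdivrMr.
have E2 : - (a y - a q) <= 5 / 100 * N q y by rewrite -ler_pdivrMr // mulNr.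
lra.
Qed.

Lemma three_on_one_side x y z : uniq [:: p; q; x; y; z] ->
  b p <= b x -> b p <= b y -> b p <= b z -> False.
Proof.
move=> U bx by_ bz.
have [xy|/ltW xy] := leP (a x) (a y); have [yz|/ltW yz] := leP (a y) (a z);
have [xz|/ltW xz] := leP (a x) (a z).
- exact: (three_on_one_side_sorted U).
- exact: (three_on_one_side_sorted U).
- apply: (@three_on_one_side_sorted x z y) => //.
  by rewrite (perm_uniq (s2 := [:: p; q; x; y; z])) //= !perm_cons (perm_catC [:: z]).
- apply: (@three_on_one_side_sorted z x y) => //.
  by rewrite (perm_uniq (s2 := [:: p; q; x; y; z])) //= !perm_cons (perm_catC [:: z]).
- apply: (@three_on_one_side_sorted y x z) => //.
  by rewrite (perm_uniq (s2 := [:: p; q; x; y; z])) //= !perm_cons (perm_catCA [:: y] [:: x]).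
- apply: (@three_on_one_side_sorted y z x) => //.
  by rewrite (perm_uniq (s2 := [:: p; q; x; y; z])) //= !perm_cons (perm_catC [:: y; z]).
- apply: (@three_on_one_side_sorted z y x) => //.
  rewrite (perm_uniq (s2 := [:: p; q; x; y; z])) //= !perm_cons.
  by rewrite -[[:: z; y; x]]/(rev [:: x; y; z]) perm_rev.
- apply: (@three_on_one_side_sorted z y x) => //.
  rewrite (perm_uniq (s2 := [:: p; q; x; y; z])) //= !perm_cons.
  by rewrite -[[:: z; y; x]]/(rev [:: x; y; z]) perm_rev.
Qed.

Let below (c : T) x z : x != c -> z != c ->
  -(5 / 100) <= f c x <= 5 / 100 -> 0 <= g c x -> - (1 / 10) <= g c z.
Proof.
move=> xc zc /andP[f1 f2] g0.
have ux : almost_unit (g c x) (f c x).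
  by apply: almost_unitC; apply: unit_fg; rewrite eq_sym.
have gx : 98 / 100 <= g c x.
  by apply: (almost_unit_large (c := 1 / 20) ux); try (apply/andP; split); lra.
have uz : almost_unit (f c z) (g c z) by apply: unit_fg; rewrite eq_sym.
have /andP[z1 z2] := almost_unit_bound uz.
have A := angle xc zc.
have F : f c x * f c z <= 6 / 100.
  apply: le_trans (ler_norm _) _; rewrite normrM.
  have -> : 6 / 100 = (5 / 100) * (6 / 5) :> R by lra.
  apply: ler_pM => //; rewrite ler_norml; apply/andP; split => //.
  - by lra.
  - by lra.
rewrite leNgt; apply/negP => gz.
have : 0 <= (g c x - 98 / 100) * (- g c z - 1 / 10).
  by apply: mulr_ge0; lra.
by lra.
Qed.

Lemma two_on_one_side_one_below_sorted x y z : uniq [:: p; q; x; y; z] ->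
  b p <= b x -> b p <= b y -> b z <= b p -> a x <= a y -> False.
Proof.
rewrite /= !inE !negb_or -!andbA => /and5P[_ px py pz] /and5P[qx qy qz xy].
move=> /and3P[xz yz _] bx by_ bz axy.
have [xp xq yp yq] : [/\ x != p, x != q, y != p & y != q] by split; rewrite eq_sym.
have [zp zq] : z != p /\ z != q by split; rewrite eq_sym.
have [fpx fqy] := two_on_one_side xp xq yp yq xy bx by_ axy.
have fpx' := fp_ge xp; have fqy' := fq_le yq.
have fpz := fp_ge zp; have fqz := fq_le zq.
have gpz : - (1 / 10) <= g p z.
  apply: (@below p x) => //; last exact: g_ge0.
  by apply/andP; split; lra.
have gqz : - (1 / 10) <= g q z.
  apply: (@below q y) => //; last by apply: g_ge0; rewrite // -(an_horizontal ab).
  by apply/andP; split; lra.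
have gpz0 : g p z <= 0.
  by rewrite -oppr_ge0 -gC; apply: g_ge0.
have gqz0 : g q z <= 0.
  by rewrite -oppr_ge0 -gC; apply: g_ge0; rewrite // -(an_horizontal ab).
have fpzl : 98 / 100 <= f p z.
  by apply: (almost_unit_large (c := 1 / 10) (unit_fg pz)); try (apply/andP; split); lra.
have fqzl : 98 / 100 <= - f q z.
  by apply: (almost_unit_large (c := 1 / 10) (almost_unitNl (unit_fg qz))); try (apply/andP; split); lra.
have := angle pz qz; rewrite (fC p) (gC p) (fC q) (gC q) => A.
have P1 : 0 <= (f p z - 98 / 100) * (- f q z - 98 / 100).
  by apply: mulr_ge0; lra.
have P2 : 0 <= (g p z + 1 / 10) * (- g q z).
  by apply: mulr_ge0; lra.
by lra.
Qed.
End PlanarPoints.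

Section UpperBounds.
Context {R : realType}.
Local Open Scope ring_scope.

Lemma two_on_one_side_one_below (T : eqType) (a b : T -> R) N p q x y z :
  almost_nonobtuse a b N p q -> p != q -> uniq [:: p; q; x; y; z] ->
  b p <= b x -> b p <= b y -> b z <= b p -> False.
Proof.
move=> ab pq U bx by_ bz; have [xy|/ltW yx] := leP (a x) (a y).
  exact: (two_on_one_side_one_below_sorted ab pq U).
apply: (@two_on_one_side_one_below_sorted _ _ _ _ _ _ _ ab pq y x z) => //.
by rewrite (perm_uniq (s2 := [:: p; q; x; y; z])) //= !perm_cons (perm_catCA [:: y] [:: x]).
Qed.

Lemma no_five_almost_nonobtuse (T : eqType) (a b : T -> R) N p q x y z :
  almost_nonobtuse a b N p q -> p != q -> uniq [:: p; q; x; y; z] -> False.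
Proof.
move=> ab pq U; have ab' := almost_nonobtuseN ab.
have Uxzy : uniq [:: p; q; x; z; y].
  by rewrite (perm_uniq (s2 := [:: p; q; x; y; z])) //= !perm_cons (perm_catC [:: z]).
have Uyzx : uniq [:: p; q; y; z; x].
  by rewrite (perm_uniq (s2 := [:: p; q; x; y; z])) //= !perm_cons (perm_catC [:: y; z]).
have [bx|/ltW bx] := leP (b p) (b x); have [by_|/ltW by_] := leP (b p) (b y);
have [bz|/ltW bz] := leP (b p) (b z).
- exact: (three_on_one_side ab pq U).
- exact: (two_on_one_side_one_below ab pq U).
- exact: (two_on_one_side_one_below ab pq Uxzy).
- by apply: (two_on_one_side_one_below ab' pq Uyzx); rewrite lerN2.
- exact: (two_on_one_side_one_below ab pq Uyzx).
- by apply: (two_on_one_side_one_below ab' pq Uxzy); rewrite lerN2.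
- by apply: (two_on_one_side_one_below ab' pq U); rewrite lerN2.
- by apply: (three_on_one_side ab' pq U); rewrite lerN2.
Qed.

Lemma exists_orthogonal m n (h : 'I_m -> 'rV[R]_n) : (m < n)%N ->
  exists2 v, dot v v = 1 & forall i, dot v (h i) = 0.
Proof.
move=> mn; pose A : 'M[R]_(n, m) := \matrix_(i, j) h j 0 i.
have : kermx A != 0.
  by rewrite -mxrank_eq0 mxrank_ker -lt0n subn_gt0 (leq_ltn_trans (rank_leq_col A)).
move=> /rowV0Pn[v /sub_kermxP vA v0]; have v0' : v <> 0 by apply/eqP.
exists (unit_vec v) => [|i]; first exact: dot_unit_vec.
rewrite dotZl; suff -> : dot v (h i) = 0 by rewrite mulr0.
have := congr1 (fun B : 'rV_m => B 0 i) vA; rewrite !mxE => <-.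
by apply: eq_bigr => j _; rewrite !mxE.
Qed.

Definition unbounded_dn (d k : nat) : Prop := forall r, exists V : {fset 'rV[R]_d},
  contains_subgraph (@dn_graph R d V) (@complete_multipartite k r).

Lemma almost_orthogonal_setup (k e : nat) : (0 < k)%N -> unbounded_dn (k + e) k ->
  exists c : R, exists p u : 'I_k -> 'rV[R]_(k + e),
  [/\ 0 <= c <= 1, forall i j, i != j -> p i <> p j,
      forall a b c, a != b -> c != b -> 0 <= dot (p a - p b) (p c - p b),
      forall i a b, `|dot (u i) (p a - p b)| <= c * norm (p a - p b) &
      forall f : 'I_e -> 'rV[R]_(k + e), (forall i j, `|dot (u i) (f j)| <= c) ->
        (forall i j, dot (f i) (f j) = (i == j)%:R) ->
        forall a b a' b', let v := p a - p b in let w := p a' - p b' in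
        `|dot v w - \sum_i dot v (f i) * dot w (f i)| <= 1 / 100 * norm v * norm w].
Proof.
move=> k0 HV; pose K := (k + e + k)%N; pose M := (300 * K)%N.
have K0 : (0 < K)%N by rewrite /K addnC addn_gt0 k0.
have M2 : (2 <= M)%N by rewrite /M (leq_trans (_ : 2 <= 300 * 1)%N) // leq_mul2l.
have [p [u [pne pang uu uij up]]] := multipartite_almost_orthogonal M2 HV.
have K0' : 1 <= K%:R :> R by rewrite ler1n.
have cE : 3 * M%:R^-1 = 1 / 100 / K%:R :> R.
  rewrite /M natrM invfM mulrA; congr (_ * _); clear; lra.
have c0 : 0 <= 3 * M%:R^-1 :> R by rewrite mulr_ge0 ?invr_ge0.
have c1 : 3 * M%:R^-1 <= 1 :> R.
  by rewrite cE ler_pdivrMr; lra.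
have cle : 0 <= (3 * M%:R^-1 : R) <= 1 by rewrite c0.
exists (3 * M%:R^-1), p, u; split => //.
move=> f uf ff a b a' b'; set v := p a - p b; set w := p a' - p b'; rewrite /=.
have := @almost_orthogonal_complement R k e u f _ v w cle uu uij uf ff (fun i => up i a b) (fun i => up i a' b').
by rewrite -/K cE [K%:R * _]mulrC divfK // gt_eqF // ltr0n.
Qed.

Lemma no_unbounded_dn_line k : (3 <= k)%N -> ~ unbounded_dn (k + 1) k.
Proof.
move=> k3 HV; have k0 : (0 < k)%N by exact: leq_trans k3.
have [c [p [u [_ pne pang up H]]]] := almost_orthogonal_setup k0 HV.
pose i0 : 'I_k := Ordinal k0; pose i1 : 'I_k := Ordinal (leq_trans (isT : 1 < 3)%N k3).
pose i2 : 'I_k := Ordinal k3.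
pose v := p i2 - p i0; pose w := p i1 - p i0; pose z := p i2 - p i1.
have w0 : w <> 0 by move=> /subr0_eq; apply: pne.
have v0 : 0 < norm v by apply: norm_gt0 => /subr0_eq; apply: pne.
have z0 : 0 < norm z by apply: norm_gt0 => /subr0_eq; apply: pne.
have wn0 := norm_gt0 w0.
pose f (i : 'I_1) := unit_vec w.
have uf i j : `|dot (u i) (f j)| <= c.
  rewrite dotZr normrM ger0_norm ?invr_ge0 ?norm_ge0 // ler_pdivrMl // mulrC.
  exact: up.
have ff i j : dot (f i) (f j) = (i == j)%:R.
  by rewrite dot_unit_vec // !ord1.
have {}H := H f uf ff.
have wf : dot w (unit_vec w) = norm w.
  by rewrite dotZr -sqr_norm expr2 mulrA mulVf ?mul1r // gt_eqF.
have vv := H i2 i0 i2 i0; have zz := H i2 i1 i2 i1; have vz := H i2 i0 i2 i1.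
have vw := H i2 i0 i1 i0; have zw := H i2 i1 i1 i0.
rewrite /= !big_ord1 -/v -/w -/z /f in vv zz vz vw zw.
have Avw : 0 <= dot v w by apply: pang.
have Azw : dot z w <= 0.
  by have := @pang i2 i1 i0 isT isT; rewrite -[p i0 - _]opprB dotNr oppr_ge0.
have Avz : 0 <= dot v z.
  have := @pang i0 i2 i1 isT isT; rewrite -[p i0 - _]opprB -[p i1 - _]opprB.
  by rewrite dotNl dotNr opprK.
have vE : dot v (unit_vec w) * norm w = dot v w.
  by rewrite dotZr mulrAC mulVf ?mul1r // gt_eqF.
have zE : dot z (unit_vec w) * norm w = dot z w.
  by rewrite dotZr mulrAC mulVf ?mul1r // gt_eqF.
have vp : 0 <= dot v (unit_vec w) by rewrite -(pmulr_lge0 _ wn0) vE.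
have zn : dot z (unit_vec w) <= 0 by rewrite -(pmulr_lle0 _ wn0) zE.
move: vv zz vz; rewrite -!sqr_norm.
move: (dot v (unit_vec w)) (dot z (unit_vec w)) vp zn => x y x0 y0.
move: (norm v) (norm z) v0 z0 Avz => nv nz nv0 nz0 Avz.
rewrite !ler_norml => /andP[_ vv] /andP[_ zz] /andP[_ vz].
have x1 : nv / 2 < x.
  rewrite ltNge; apply/negP => xn.
  have h1 : 0 <= (nv / 2 - x) * (nv / 2 + x) by apply: mulr_ge0; clear -xn x0; lra.
  have h2 : 0 < nv * nv by rewrite mulr_gt0.
  by clear -h1 h2 vv; lra.
have y1 : nz / 2 < - y.
  rewrite ltNge; apply/negP => yn.
  have h1 : 0 <= (nz / 2 + y) * (nz / 2 - y) by apply: mulr_ge0; clear -yn y0; lra.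
  have h2 : 0 < nz * nz by rewrite mulr_gt0.
  by clear -h1 h2 zz; lra.
have h : 0 <= (x - nv / 2) * (- y - nz / 2) by apply: mulr_ge0; clear -x1 y1; lra.
have h1 : 0 <= (x - nv / 2) * nz by apply: mulr_ge0; clear -x1 nz0; lra.
have h2 : 0 <= nv * (- y - nz / 2) by apply: mulr_ge0; clear -y1 nv0; lra.
have h3 : 0 < nv * nz by rewrite mulr_gt0.
by clear -h h1 h2 h3 vz Avz; lra.
Qed.

Lemma no_unbounded_dn_plane k : (5 <= k)%N -> ~ unbounded_dn (k + 2) k.
Proof.
move=> k5 HV; have k0 : (0 < k)%N by exact: leq_trans k5.
have [c [P [u [/andP[c0 _] pne pang up H]]]] := almost_orthogonal_setup k0 HV.
pose i0 : 'I_k := Ordinal k0.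
pose i1 : 'I_k := Ordinal (leq_trans (isT : 1 < 5)%N k5).
pose N i j := norm (P j - P i).
have Npos i j : i != j -> 0 < N i j.
  by rewrite eq_sym => ij; apply: norm_gt0 => /subr0_eq; exact: pne.
have [p [q diam]] : exists p q, forall i j, N i j <= N p q.
  case: (@Order.TotalTheory.arg_maxP _ _ _ (i0, i0) xpredT (fun x => N x.1 x.2) isT) => -[p q] _ h.
  by exists p, q => i j; apply: (h (i, j)).
have pq : p != q.
  apply/eqP => pq; have := diam i0 i1; have := @Npos i0 i1 isT.
  rewrite pq /N subrr /(norm 0) -[X in dot X _](subrr (0 : 'rV[R]_(k + 2))) dotBl subrr sqrtr0.
  by move=> /lt_le_trans h /h; rewrite ltxx.
pose w := P q - P p.
have wn0 : 0 < norm w by exact: Npos.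
have w0 : w <> 0 by move=> /subr0_eq; apply: pne; rewrite eq_sym.
pose f0 := unit_vec w.
have [f1 f11 f1h] := @exists_orthogonal k.+1 (k + 2)
  (fun i => if unlift ord0 i is Some j then u j else f0) ltac:(by rewrite addn2).
have f10 : dot f1 f0 = 0 by have := f1h ord0; rewrite unlift_none.
have f1u i : dot f1 (u i) = 0 by have := f1h (lift ord0 i); rewrite liftK.
have f00 : dot f0 f0 = 1 by exact: dot_unit_vec.
pose f (i : 'I_2) := if i == ord0 then f0 else f1.
have uf i j : `|dot (u i) (f j)| <= c.
  rewrite /f; case: ifP => _; last by rewrite dotC f1u normr0.
  rewrite dotZr normrM ger0_norm ?invr_ge0 ?norm_ge0 // ler_pdivrMl // mulrC.
  exact: up.
have ff i j : dot (f i) (f j) = (i == j)%:R.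
  by case: (unliftP ord0 i) => [i'|] ->; case: (unliftP ord0 j) => [j'|] ->;
    rewrite /f ?ord1 //= dotC.
have {H} H a b a' b' : `|dot (P a - P b) (P a' - P b') -
    (dot (P a - P b) f0 * dot (P a' - P b') f0 +
     dot (P a - P b) f1 * dot (P a' - P b') f1)| <=
    1 / 100 * norm (P a - P b) * norm (P a' - P b').
  by have := H f uf ff a b a' b'; rewrite /= big_ord_recl big_ord1.
have ab : almost_nonobtuse (fun i => dot (P i) f0) (fun i => dot (P i) f1) N p q.
  split => //.
  - by move=> i j; rewrite /N -opprB normN.
  - move=> i j ij; rewrite -!dotBl; have := H j i j i.
    have := Npos i j ij; rewrite /N -sqr_norm.
    move: (dot _ f0) (dot _ f1) (norm _) => x y n n0.
    rewrite ler_norml => /andP[h1 h2].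
    have n2 : 0 < n ^+ 2 by rewrite exprn_gt0.
    rewrite /almost_unit !exprMn !exprVn -mulrDl ler_pdivlMr // ler_pdivrMr //.
    by clear -h1 h2; split; lra.
  - move=> i j l ij lj; rewrite -!dotBl; have := H i j l j; have := pang _ _ _ ij lj.
    have := Npos j i; have := Npos j l; rewrite ![j == _]eq_sym => /(_ lj) + /(_ ij); rewrite /N.
    move: (dot _ (P l - _)) (dot (P i - _) f0) (dot (P i - _) f1) (norm (P i - _)).
    move: (dot _ f0) (dot _ f1) (norm _) => x y n t x' y' n' n0 n0' t0.
    rewrite ler_norml => /andP[h1 h2].
    have nn : 0 < n' * n by rewrite mulr_gt0.
    rewrite !mulf_div -mulrDl ler_pdivlMr //.
    by clear -t0 h2; lra.
  - by apply: subr0_eq; rewrite -dotBl -[_ - _]opprB dotNl -/w dotC -(scale_unit_vec w0) dotZr f10 mulr0 oppr0.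
  - by rewrite -dotBl -/w dotZr -sqr_norm expr2 mulrA mulVf ?mul1r // gt_eqF.
have : (2 < size [seq x <- enum 'I_k | x \notin [:: p; q]])%N.
  have := count_predC (mem [:: p; q]) (enum 'I_k); rewrite size_enum_ord.
  rewrite size_filter => kE.
  have : (count (mem [:: p; q]) (enum 'I_k) <= 2)%N.
    rewrite -size_filter -[leqRHS]/(size [:: p; q]); apply: uniq_leq_size.
      by rewrite filter_uniq // enum_uniq.
    by move=> x; rewrite mem_filter => /andP[].
  have := k5; rewrite -[X in (5 <= X)%N]kE; set A := count _ _; set B := count _ _.
  by move=> k5' A2; rewrite -(ltn_add2l 2) (leq_trans k5') // leq_add2r.
have : uniq [seq x <- enum 'I_k | x \notin [:: p; q]] by rewrite filter_uniq // enum_uniq.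
have : all (fun x => x \notin [:: p; q]) [seq x <- enum 'I_k | x \notin [:: p; q]] by exact: filter_all.
case: [seq _ <- _ | _] => [|x [|y [|z s]]] //= /and4P[xpq ypq zpq _] U _.
apply: (no_five_almost_nonobtuse (x := x) (y := y) (z := z) ab pq).
move: U xpq ypq zpq; rewrite /= !inE !negb_or pq /= ![_ == p]eq_sym ![_ == q]eq_sym.
move=> /and4P[/and3P[-> -> _] /andP[-> _] _ _].
by move=> /andP[-> ->] /andP[-> ->] /andP[-> ->].
Qed.

Lemma unbounded_dn_leq d k n : (k <= n)%N -> unbounded_dn d n -> unbounded_dn d k.
Proof.
move=> kn HV r; have [V HVr] := HV r; exists V.
exact: contains_multipartite_leq kn HVr.
Qed.

End UpperBounds.

Section LowerBounds.
Context {R : realType}.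
Local Open Scope ring_scope.

Lemma strict_double_normalI d (V : {fset 'rV[R]_d}) p q :
  p \in V -> q \in V -> p <> q ->
  (forall x, x \in V -> x <> p -> 0 < dot (x - p) (q - p)) ->
  (forall x, x \in V -> x <> q -> 0 < dot (x - q) (p - q)) ->
  strict_double_normal V p q.
Proof.
move=> pV qV pq Hp Hq; split; first split => // x /= xV; first split.
- have [->|/eqP xp] := eqVneq x p; last by rewrite ltW // Hp.
  by rewrite -[p in p - _]addr0 addrAC subrr add0r /dot big1 // => i _; rewrite mxE mul0r.
- have [->|/eqP xq] := eqVneq x q; last by rewrite -(opprB p q) dotNr oppr_le0 ltW // Hq.
  by rewrite -[q in q - _]addr0 addrAC subrr add0r /dot big1 // => i _; rewrite mxE mul0r.
apply/seteqP; split => x /= => [[xV [xp|xq]]|[->|->]].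
- left; apply: contrapT => ne; have := Hp _ xV ne; by rewrite xp ltxx.
- right; apply: contrapT => ne; have := Hq _ xV ne.
  by rewrite -(opprB q p) dotNr xq oppr0 ltxx.
- split => //; left; rewrite /hyperplane /= subrr /dot big1 // => i _.
  by rewrite mxE mul0r.
- split => //; right; rewrite /hyperplane /= subrr /dot big1 // => i _.
  by rewrite mxE mul0r.
Qed.

Lemma dot_row_mx m n (u u' : 'rV[R]_m) (v v' : 'rV[R]_n) :
  dot (row_mx u v) (row_mx u' v') = dot u u' + dot v v'.
Proof.
rewrite /dot big_split_ord /=; congr (_ + _); apply: eq_bigr => i _.
  by rewrite !row_mxEl.
by rewrite !row_mxEr.
Qed.

Lemma dot_delta_mx n (i : 'I_n) (v : 'rV[R]_n) : dot (delta_mx 0 i) v = v 0 i.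
Proof.
rewrite /dot (bigD1 i) //= mxE !eqxx mul1r big1 ?addr0 // => j ji.
by rewrite mxE (negbTE ji) andbF mul0r.
Qed.

(* The vertices of an acute simplex with orthocenter 0. *)
Lemma orthocentric_simplex n : (0 < n)%N -> exists (kappa : R) (p : 'I_n.+1 -> 'rV[R]_n),
  0 < kappa /\ forall i j, i != j -> dot (p i) (p j) = - kappa.
Proof.
move=> n0; have n0' : 0 < n%:R :> R by rewrite ltr0n.
pose b : R := 3 / 2 / n%:R; pose o : 'rV[R]_n := const_mx 1.
have bn : b * n%:R = 3 / 2 by rewrite divfK // gt_eqF.
have oo : dot o o = n%:R.
  rewrite /dot; under eq_bigr do rewrite !mxE mulr1.
  by rewrite sumr_const card_ord.
have do_ i : dot (delta_mx 0 i) o = 1 by rewrite dot_delta_mx mxE.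
have dd i j : i != j -> dot (delta_mx 0 i) (delta_mx 0 j : 'rV[R]_n) = 0.
  by move=> ij; rewrite dot_delta_mx mxE (negbTE ij) andbF.
have b0 : 0 < b by rewrite !divr_gt0.
have k1 i : dot (delta_mx 0 i - b *: o) (b *: o) = - (b / 2).
  by rewrite !dotE do_ oo bn; lra.
exists (b / 2), (fun i => if unlift ord0 i is Some j then delta_mx 0 j - b *: o else b *: o).
split; first by rewrite divr_gt0.
move=> i j; case: (unliftP ord0 i) => [i'|] ->; case: (unliftP ord0 j) => [j'|] -> //.
- rewrite (inj_eq lift_inj) => ij.
  rewrite dotBr k1 dotBl dd // dotZl [dot o _]dotC do_; lra.
- by move=> _; rewrite dotC k1.
Qed.

Lemma same_part_positive (k A c c' cj s s' t N e : R) :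
  0 < k -> 0 <= A -> 1 - t <= c <= 1 -> 1 - t <= cj <= 1 -> 0 < N ->
  0 <= t -> t * N < 1 / 2 -> 0 < e -> 0 <= s <= N * e -> 0 <= s' <= N * e ->
  c - c' = (s' ^+ 2 - s ^+ 2) / (2 * (k + A)) -> (s + e <= s') \/ (s' + e <= s) ->
  0 < (c - c') * (k * cj + A * c) + s * (s - s').
Proof.
move=> k0 A0 /andP[c1 c2] /andP[j1 j2] N0 t0 tN e0 /andP[s0 sN] /andP[s'0 s'N] cc ss.
pose m := (k * cj + A * c) / (2 * (k + A)).
have kA : 0 < 2 * (k + A) by lra.
have -> : (c - c') * (k * cj + A * c) + s * (s - s') = (s' - s) * (m * (s' + s) - s).
  by rewrite cc /m; field; rewrite gt_eqF //; lra.
have m1 : (1 - t) / 2 <= m.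
  rewrite ler_pdivlMr //.
  have h1 : 0 <= k * (cj - (1 - t)) by apply: mulr_ge0; lra.
  have h2 : 0 <= A * (c - (1 - t)) by apply: mulr_ge0; lra.
  by clear -h1 h2; lra.
have m2 : m <= 1 / 2.
  rewrite ler_pdivrMr //.
  have h1 : 0 <= k * (1 - cj) by apply: mulr_ge0; lra.
  have h2 : 0 <= A * (1 - c) by apply: mulr_ge0; lra.
  by clear -h1 h2; lra.
case: ss => ss.
  apply: mulr_gt0; first by clear -ss e0; lra.
  have h1 : 0 <= (m - (1 - t) / 2) * (s' + s) by apply: mulr_ge0; clear -m1 s0 s'0; lra.
  have h2 : 0 <= t * (2 * (N * e) - s' - s) by apply: mulr_ge0; clear -t0 sN s'N; lra.
  have h3 : 0 < (1 / 2 - t * N) * e by apply: mulr_gt0; clear -tN e0; lra.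
  by clear -h1 h2 h3 ss; lra.
rewrite -mulrNN; apply: mulr_gt0; first by clear -ss e0; lra.
have h1 : 0 <= (1 / 2 - m) * (s' + s) by apply: mulr_ge0; clear -m2 s0 s'0; lra.
by clear -h1 ss e0; lra.
Qed.

(* The i-th part lies on a parabola-like arc that is tangent at p i to the i-th
   of k new axes; its curvature is chosen so that the arc is, to second order,
   equidistant from all the other vertices of the simplex. *)
Lemma strict_multipartite n k r (kappa : R) (p : 'I_k -> 'rV[R]_n) : 0 < kappa ->
  (forall i j, i != j -> dot (p i) (p j) = - kappa) ->
  exists V : {fset 'rV[R]_(n + k)},
    contains_subgraph (@strict_dn_graph R (n + k) V) (@complete_multipartite k r).
Proof.
move=> k0 pp; pose A i := dot (p i) (p i); have A0 i : 0 <= A i by exact: dot_ge0.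
pose N : R := r.+1%:R; have N1 : 1 <= N by rewrite ler1n.
pose t : R := (4 * N)^-1.
have t0 : 0 < t by rewrite invr_gt0; lra.
have tN : t * N = 1 / 4 by rewrite /t invfM -mulrA mulVf ?gt_eqF //; lra.
have t4 : t <= 1 / 4.
  by rewrite -tN ler_peMr // ltW.
pose x : R := 1 + N ^+ 2 / (2 * kappa * t).
have x1 : 1 <= x by rewrite lerDl divr_ge0 ?sqr_ge0 // !mulr_ge0 ?ltW.
pose e := x^-1; have e0 : 0 < e by rewrite invr_gt0; lra.
have e1 : e <= 1 by rewrite invf_le1 //; lra.
have eN : (N * e) ^+ 2 / (2 * kappa) <= t.
  have kt : 0 < 2 * kappa * t by rewrite !mulr_gt0.
  have h : N ^+ 2 / (2 * kappa * t) * e <= 1.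
    have x0 : 0 < x by lra.
    by rewrite /e ler_pdivrMr // mul1r /x lerDr.
  have h2 : N ^+ 2 / (2 * kappa * t) * e ^+ 2 <= 1.
    apply: le_trans h; apply: ler_wpM2l; first by rewrite divr_ge0 ?sqr_ge0 ?(ltW kt).
    by rewrite expr2 ler_piMl ?(ltW e0).
  rewrite -[leRHS]mul1r -ler_pdivrMr //.
  apply: le_trans h2; rewrite le_eqVlt; apply/orP; left; apply/eqP.
  by rewrite exprMn; field; rewrite !gt_eqF.
pose s (a : 'I_r) : R := a%:R * e.
have s0 a : 0 <= s a by rewrite mulr_ge0 // ltW.
have sN a : s a <= N * e by rewrite ler_pM2r // ler_nat ltnW // ltnS ltnW.
have ss a b : a != b -> s a + e <= s b \/ s b + e <= s a.
  rewrite -val_eqE neq_ltn => /orP[ab|ab]; [left|right];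
    by rewrite /s -[X in _ + X <= _]mul1r -mulrDl ler_pM2r // natr1 ler_nat.
pose c i a := 1 - s a ^+ 2 / (2 * (kappa + A i)).
have kA i : 0 < 2 * (kappa + A i) by have := A0 i; lra.
have cP i a : 1 - t <= c i a <= 1.
  rewrite /c lerD2l lerN2 gerDl oppr_le0 divr_ge0 ?sqr_ge0 ?(ltW (kA i)) // andbT.
  apply: le_trans eN; apply: ler_pM; rewrite ?sqr_ge0 ?invr_ge0 ?(ltW (kA i)) //.
    by rewrite ler_sqr ?nnegrE // mulr_ge0 ?(ltW e0) //; lra.
  by rewrite lef_pV2 ?posrE ?mulr_gt0 //; have := A0 i; lra.
have cl i a : 3 / 4 <= c i a by have /andP[h _] := cP i a; lra.
have cu i a : c i a <= 1 by have /andP[] := cP i a.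
pose P (y : 'I_k * 'I_r) : 'rV[R]_(n + k) :=
  row_mx (c y.1 y.2 *: p y.1) (s y.2 *: delta_mx 0 y.1).
have dsame i a b : dot (P (i, a)) (P (i, b)) = c i a * c i b * A i + s a * s b.
  rewrite dot_row_mx !dotZl !dotZr dot_delta_mx mxE !eqxx mulr1 /=; congr (_ + _).
  by rewrite mulrA.
have ddiff i j a b : i != j -> dot (P (i, a)) (P (j, b)) = - (kappa * c i a * c j b).
  move=> ij; rewrite dot_row_mx !dotZl !dotZr dot_delta_mx mxE (negbTE ij) andbF !mulr0 addr0 /=.
  by rewrite pp //; ring.
have key i j a b y : i != j -> y != (i, a) -> 0 < dot (P y - P (i, a)) (P (j, b) - P (i, a)).
  case: y => l a' ij ya; rewrite !dotE.
  have [li|li] := eqVneq l i.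
    rewrite li in ya *; rewrite xpair_eqE eqxx /= in ya.
    rewrite !dsame !ddiff //.
    have -> : - (kappa * c i a' * c j b) - (c i a' * c i a * A i + s a' * s a) -
      (- (kappa * c i a * c j b) - (c i a * c i a * A i + s a * s a)) =
      (c i a - c i a') * (kappa * c j b + A i * c i a) + s a * (s a - s a') by ring.
    apply: (same_part_positive (N := N) (t := t) (e := e)) => //; rewrite ?s0 ?sN //.
    - by rewrite ltW.
    - by rewrite tN; lra.
    - by rewrite /c mulrBl; ring.
    - by apply: ss; rewrite eq_sym.
  rewrite dsame (ddiff i) // (ddiff l i) //.
  have h1 := s0 a; have h2 := cl i a; have h3 := cl j b; have h4 := cl l a'.
  have h5 := cu j b; have h6 := cu l a'; have h7 := A0 i; have h8 := cu i a.
  have h9 : 0 <= c i a * c i a * A i + s a * s a.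
    by rewrite addr_ge0 // !mulr_ge0 //; lra.
  have H1 : 0 <= c l a' * (1 - c j b) by apply: mulr_ge0; lra.
  have H2 : 0 <= (c i a - 3 / 4) * (c j b + c l a') by apply: mulr_ge0; lra.
  have {H1 H2}H : 0 < kappa * (c i a * c j b + c i a * c l a' - c l a' * c j b).
    by apply: mulr_gt0 => //; clear -H1 H2 h3 h4 h6; lra.
  have [lj|lj] := eqVneq l j.
    rewrite lj dsame.
    have h10 : 0 <= c j a' * c j b * A j + s a' * s b.
      have := cl j a'; have := A0 j => g1 g2.
      by rewrite addr_ge0 // !mulr_ge0 //; lra.
    have H3 : 0 <= kappa * (c l a' * c j b).
      by rewrite !mulr_ge0 ?ltW //; lra.
    by rewrite lj in H H3; clear -H H3 h9 h10; lra.
  by rewrite ddiff //; clear -H h9; lra.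
have Pinj : injective P.
  move=> [i a] [j b] PP; have [ij|ij] := eqVneq i j; last first.
    have := dot_ge0 (P (i, a)); rewrite [X in dot _ X]PP ddiff // oppr_ge0 leNgt.
    have h1 := cl i a; have h2 := cl j b.
    have c1 : 0 < c i a by clear -h1; lra.
    have c2 : 0 < c j b by clear -h2; lra.
    by rewrite !mulr_gt0.
  rewrite -ij in PP *; congr (_, _); apply/eqP/negPn/negP => ab.
  have := congr1 (fun M => (rsubmx M) 0 i) PP; rewrite !row_mxKr !mxE !eqxx !mulr1 /=.
  by case: (ss _ _ ab); lra.
pose V : {fset 'rV[R]_(n + k)} := [fset P y | y in {: 'I_k * 'I_r}]%fset.
have PV y : P y \in V by apply: in_imfset.
exists V, (fun y => [` PV y]%fset); split.
  by move=> y y' /(congr1 val) /= /Pinj.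
move=> [i a] [j b] /= /eqP ij; rewrite /complete_multipartite /strict_dn_graph /=.
apply: strict_double_normalI => //.
- by move=> /Pinj [ij' _]; rewrite ij' eqxx in ij.
- move=> _ /imfsetP[y _ ->] ne; apply: key => //.
  by apply/eqP => yE; apply: ne; rewrite yE.
- move=> _ /imfsetP[y _ ->] ne; apply: key; first by rewrite eq_sym.
  by apply/eqP => yE; apply: ne; rewrite yE.
Qed.

Lemma unbounded_strict_dn n k : (0 < n)%N -> (k <= n.+1)%N ->
  forall r, exists V : {fset 'rV[R]_(n + k)},
    contains_subgraph (@strict_dn_graph R (n + k) V) (@complete_multipartite k r).
Proof.
move=> n0 kn r; have [kappa [p [k0 pp]]] := orthocentric_simplex n0.
by apply: (strict_multipartite r (p := fun i => p (widen_ord kn i)) k0) => i j ij; apply: pp.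
Qed.

End LowerBounds.

Section Values.
Context {R : realType}.

Lemma k_k'_eq d m :
  (forall r, exists V : {fset 'rV[R]_d},
    contains_subgraph (@strict_dn_graph R d V) (@complete_multipartite m r)) ->
  ~ @unbounded_dn R d m.+1 -> k'_eq R d m /\ k_eq R d m.
Proof.
move=> low up.
have weaken k : (forall r, exists V : {fset 'rV[R]_d},
    contains_subgraph (@strict_dn_graph R d V) (@complete_multipartite k r)) ->
    @unbounded_dn R d k.
  move=> H r; have [V [f [fi fE]]] := H r; exists V, f; split => // x y /fE.
  by case.
have upper k : @unbounded_dn R d k -> (k <= m)%N.
  move=> H; rewrite leqNgt; apply/negP => mk; apply: up; exact: unbounded_dn_leq mk H.
split; split => //.
- by move=> k /weaken /upper.
- exact: weaken.
Qed.

End Values.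

Theorem corollary1 (R : realType) :
  (k'_eq R 4 2 /\ k_eq R 4 2) /\
  (k'_eq R 5 3 /\ k_eq R 5 3) /\
  (k'_eq R 7 4 /\ k_eq R 7 4).
Proof.
split; last split; apply: k_k'_eq.
- exact: (@unbounded_strict_dn R 2 2).
- exact: (@no_unbounded_dn_line R 3).
- exact: (@unbounded_strict_dn R 2 3).
- exact: (@no_unbounded_dn_line R 4).
- exact: (@unbounded_strict_dn R 3 4).
- exact: (@no_unbounded_dn_plane R 5).
Qed.
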